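(* Let $X$ be a metric space and let $M=\mathcal{M}(X)$ be its localic completion, with set of basic opens $S$. Let $O\subseteq S$ be such that the closed sublocale $M\setminus O$ is compact and overt. Then $\mathrm{Pt}(M\setminus O)$ is Bishop-compact.
   Context: The setting is Bishop-style constructive mathematics (intuitionistic logic) with the axiom of dependent choice. Real numbers are Dedekind reals. K-finite: a set is K-finite if it is the image of a set $\{0,\dots,n\}$, $n\ge 0$. A metric space is totally bounded if for each $\varepsilon>0$ it can be covered by a K-finite set of balls of radius at most $\varepsilon$. A subset of a metric space is Bishop-compact if it is complete and totally bounded. Formal topology: a preorder $(S,\leqslant)$ of basic opens with a relation $\vartriangleleft$ between elements and subsets of $S$ satisfying: (Ref) $a\in U$ implies $a\vartriangleleft U$; (Tra) $a\vartriangleleft U$ and $U\vartriangleleft V$ imply $a\vartriangleleft V$, where $U\vartriangleleft V$ means $u\vartriangleleft V$ for all $u\in U$; (Loc) $a\vartriangleleft U$ and $a\vartriangleleft V$ imply $a\vartriangleleft\{x\mid \exists u\in U\,\exists v\in V.\ x\leqslant u,\ x\leqslant v\}$; (Ext) $a\leqslant b$ implies $a\vartriangleleft\{b\}$. It is compact if whenever $S\vartriangleleft U$ there is a K-finite $U_0\subseteq U$ with $S\vartriangleleft U_0$. Points: a point of $(S,\vartriangleleft)$ is an inhabited subset $\alpha\subseteq S$ that is filtering with respect to $\leqslant$ and such that $U\cap\alpha$ is inhabited whenever $a\vartriangleleft U$ for some $a\in\alpha$. $\mathrm{Pt}$ denotes the collection of points. Closed sublocale: for $O\subseteq S$, the closed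 sublocale $M\setminus O$ of $M=(S,\vartriangleleft)$ is the formal topology on the same preorder with cover $u\vartriangleleft_{-O}V$ iff $u\vartriangleleft V\cup O$. Overt: a formal topology is overt if it carries a positivity predicate, i.e. a predicate $\mathrm{Pos}$ on $S$ with (Pos) $U\vartriangleleft\{u\in U\mid \mathrm{Pos}(u)\}$ for all $U\subseteq S$; (Mon) if $\mathrm{Pos}(u)$ and $u\vartriangleleft V$ then $\mathrm{Pos}(v)$ for some $v\in V$. For $M\setminus O$, compactness, overtness and points all refer to the cover $\vartriangleleft_{-O}$. Localic completion $\mathcal{M}(X)$ of a metric space $(X,d)$: basic opens are pairs $(x,r)\in X\times\mathbb{Q}^{>0}$, written $\mathsf{b}(x,r)$. Put $\mathsf{b}(x,r)<\mathsf{b}(y,s)$ iff $d(x,y)<s-r$, and $\mathsf{b}(x,r)\leqslant\mathsf{b}(y,s)$ iff $d(x,y)<t$ for all $t>s-r$. The cover $\vartriangleleft$ is the formal topology cover inductively generated by (M1) $u\vartriangleleft\{v\mid v<u\}$ and (M2) $u\vartriangleleft\{\mathsf{b}(x,r)\mid x\in X\}$ for every basic open $u$ and every rational $r>0$. $\mathrm{Pt}(\mathcal{M}(X))$ is the metric completion of $X$, with metric $d(\alpha,\beta)=\inf\{d(x,y)+r+s\mid \mathsf{b}(x,r)\in\alpha,\ \mathsf{b}(y,s)\in\beta\}$, and $\mathrm{Pt}(M\setminus O)$ is regarded as a subset of this metric space. *)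

(* Defs.v *)
(* Everything below is stated in Rocq's intuitionistic logic, so no library of
   classical real numbers is used: the reals are two-sided Dedekind cuts in
   [rat], the metric takes values in them, and sets are types with an
   equivalence relation, subsets being Prop-valued predicates. *)
From mathcomp Require Import all_boot all_order all_algebra.
From mathcomp Require Import lra.

Set Implicit Arguments.
Unset Strict Implicit.
Unset Printing Implicit Defensive.

Import Order.TTheory GRing.Theory Num.Theory.
Local Open Scope ring_scope.

Definition dependent_choice : Prop :=
  forall (A : Type) (R : A -> A -> Prop),
    (forall a, exists b, R a b) ->
    forall a0, exists f : nat -> A, f 0%N = a0 /\ forall n, R (f n) (f n.+1).

Record real := Real {
  lower : rat -> Prop;
  upper : rat -> Prop;
  lower_inh : exists q, lower q;
  upper_inh : exists q, upper q;
  lower_rounded : forall q, lower q <-> exists r, q < r /\ lower r;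
  upper_rounded : forall q, upper q <-> exists r, r < q /\ upper r;
  cut_disjoint : forall q, ~ (lower q /\ upper q);
  cut_located : forall q r, q < r -> lower q \/ upper r }.

Definition rlt (x y : real) : Prop := exists q, upper x q /\ lower y q.
Definition rle (x y : real) : Prop := forall q, lower x q -> lower y q.
Definition req (x y : real) : Prop := rle x y /\ rle y x.

Lemma lower_lt x p q : p < q -> lower x q -> lower x p.
Proof. by move=> pq xq; apply/lower_rounded; exists q. Qed.

Lemma upper_lt x p q : p < q -> upper x p -> upper x q.
Proof. by move=> pq xq; apply/upper_rounded; exists p. Qed.

Lemma lower_le x p q : p <= q -> lower x q -> lower x p.
Proof.
by rewrite le_eqVlt => /orP[/eqP->//|]; exact: lower_lt.
Qed.

Lemma upper_le x p q : p <= q -> upper x p -> upper x q.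
Proof.
by rewrite le_eqVlt => /orP[/eqP->//|]; exact: upper_lt.
Qed.

Lemma lower_upper x p q : lower x p -> upper x q -> p < q.
Proof.
move=> xp xq; case: (ltP p q) => // qp.
by case: (@cut_disjoint x p); split=> //; apply: upper_le xq.
Qed.

Lemma rle_upper x y : rle x y <-> forall q, upper y q -> upper x q.
Proof.
split=> [xy q /upper_rounded [r [rq yr]]|xy q /lower_rounded [r [qr xr]]].
  case: (cut_located x rq) => // /xy yr'.
  by case: (@cut_disjoint y r).
case: (cut_located y qr) => // /xy xr'.
by case: (@cut_disjoint x r).
Qed.

Section RatReal.
Variable a : rat.

Lemma rat_real_lower_inh : exists q, q < a.
Proof. by exists (a - 1); lra. Qed.
Lemma rat_real_upper_inh : exists q, a < q.
Proof. by exists (a + 1); lra. Qed.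
Lemma rat_real_lower_rounded q : q < a <-> exists r, q < r /\ r < a.
Proof.
by split=> [qa|[r [qr ra]]]; [exists ((q + a) / 2%:R); split|]; lra.
Qed.
Lemma rat_real_upper_rounded q : a < q <-> exists r, r < q /\ a < r.
Proof.
by split=> [qa|[r [qr ra]]]; [exists ((q + a) / 2%:R); split|]; lra.
Qed.
Lemma rat_real_disjoint q : ~ (q < a /\ a < q).
Proof. by case; lra. Qed.
Lemma rat_real_located q r : q < r -> q < a \/ a < r.
Proof. by move=> qr; case: (ltP q a) => ?; [left|right; lra]. Qed.

Definition rat_real : real :=
  Real rat_real_lower_inh rat_real_upper_inh rat_real_lower_rounded
       rat_real_upper_rounded rat_real_disjoint rat_real_located.
End RatReal.

Lemma cut_approx x (e : rat) : 0 < e -> exists a, lower x a /\ upper x (a + e).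
Proof.
move=> e0; case: (lower_inh x) => a xa; case: (upper_inh x) => b xb.
have [n nP] : exists n : nat, b - a < n%:R * (e / 2%:R).
  exists (Num.bound `|(b - a) / (e / 2%:R)|).
  have e20 : 0 < e / 2%:R by lra.
  rewrite -ltr_pdivrMr //; apply: le_lt_trans (ler_norm _) _.
  exact: archi_boundP.
have {xb nP} : upper x (a + n%:R * (e / 2%:R)) by apply: upper_lt xb; lra.
elim: n a xa => [|n IH] a xa.
  rewrite mul0r addr0 => xa'; case: (@cut_disjoint x a) => //.
rewrite -natr1 => xb.
have lt_ae : a + e / 2%:R < a + e by lra.
case: (cut_located x lt_ae) => [xa'|]; last by exists a.
by apply: (IH _ xa'); apply: upper_le xb; lra.
Qed.

Section RealAdd.
Variables x y : real.

Definition add_lower (q : rat) : Prop := exists a b, [/\ lower x a, lower y b & q = a + b].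
Definition add_upper (q : rat) : Prop := exists a b, [/\ upper x a, upper y b & q = a + b].

Lemma add_lower_inh : exists q, add_lower q.
Proof.
case: (lower_inh x) => a xa; case: (lower_inh y) => b yb.
by exists (a + b), a, b.
Qed.
Lemma add_upper_inh : exists q, add_upper q.
Proof.
case: (upper_inh x) => a xa; case: (upper_inh y) => b yb.
by exists (a + b), a, b.
Qed.
Lemma add_lower_rounded q : add_lower q <-> exists r, q < r /\ add_lower r.
Proof.
split=> [[a [b [/lower_rounded [a' [aa' xa']] yb ->]]]|].
  by exists (a' + b); split; [lra | exists a', b].
case=> r [qr [a [b [xa yb rE]]]]; move: qr; rewrite {}rE => qr.
exists (q - b), b; split=> //; last by lra.
by apply: lower_lt xa; lra.
Qed.
Lemma add_upper_rounded q : add_upper q <-> exists r, r < q /\ add_upper r.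
Proof.
split=> [[a [b [/upper_rounded [a' [aa' xa']] yb ->]]]|].
  by exists (a' + b); split; [lra | exists a', b].
case=> r [qr [a [b [xa yb rE]]]]; move: qr; rewrite {}rE => qr.
exists (q - b), b; split=> //; last by lra.
by apply: upper_lt xa; lra.
Qed.
Lemma add_disjoint q : ~ (add_lower q /\ add_upper q).
Proof.
case=> -[a [b [xa yb ->]]] [a' [b' [xa' yb' E]]].
have := lower_upper xa xa'; have := lower_upper yb yb'; lra.
Qed.
Lemma add_located q r : q < r -> add_lower q \/ add_upper r.
Proof.
move=> qr; have e0 : 0 < (r - q) / 2%:R by lra.
case: (cut_approx x e0) => a [xa xa']; case: (cut_approx y e0) => b [yb yb'].
case: (leP q (a + b)) => [le_q|lt_q]; [left|right].
  exists (q - b), b; split=> //; last by lra.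
  by apply: lower_le xa; lra.
exists (r - (b + (r - q) / 2%:R)), (b + (r - q) / 2%:R); split=> //; last by lra.
by apply: upper_lt xa'; lra.
Qed.

Definition radd : real :=
  Real add_lower_inh add_upper_inh add_lower_rounded add_upper_rounded
       add_disjoint add_located.
End RealAdd.

(** The infimum of a set of reals exists constructively as soon as the set is
    inhabited, bounded below and located in the order. *)
Section Infimum.
Variable E : real -> Prop.

Definition inf_located : Prop := forall p q : rat, p < q ->
  (forall e, E e -> rle (rat_real p) e) \/ exists e, E e /\ rlt e (rat_real q).

Hypothesis E_inh : exists e, E e.
Hypothesis E_bounded : exists p : rat, forall e, E e -> rle (rat_real p) e.
Hypothesis E_located : inf_located.

Definition inf_lower (q : rat) : Prop :=
  exists p : rat, q < p /\ forall e, E e -> rle (rat_real p) e.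
Definition inf_upper (q : rat) : Prop := exists e, E e /\ rlt e (rat_real q).

Lemma inf_lower_inh : exists q, inf_lower q.
Proof. by case: E_bounded => p pP; exists (p - 1), p; split=> //; lra. Qed.
Lemma inf_upper_inh : exists q, inf_upper q.
Proof.
case: E_inh => e eE; case: (upper_inh e) => q eq.
by exists (q + 1), e; split=> //; exists q; split=> //=; lra.
Qed.
Lemma inf_lower_rounded q : inf_lower q <-> exists r, q < r /\ inf_lower r.
Proof.
split=> [[p [qp pP]]|[r [qr [p [rp pP]]]]]; last by exists p; split=> //; lra.
exists ((p + q) / 2%:R); split; first by lra.
by exists p; split=> //; lra.
Qed.
Lemma inf_upper_rounded q : inf_upper q <-> exists r, r < q /\ inf_upper r.
Proof.
split=> [[e [eE [p [ep /= pq]]]]|[r [rq [e [eE [p [ep /= pr]]]]]]].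
  exists ((p + q) / 2%:R); split; first by lra.
  by exists e; split=> //; exists p; split=> //=; lra.
by exists e; split=> //; exists p; split=> //=; lra.
Qed.
Lemma inf_disjoint q : ~ (inf_lower q /\ inf_upper q).
Proof.
case=> -[p [qp pP]] [e [eE [r [er /= rq]]]].
have er' : lower e r by apply: (pP e eE) => /=; lra.
exact: (@cut_disjoint e r).
Qed.
Lemma inf_cut_located q r : q < r -> inf_lower q \/ inf_upper r.
Proof.
move=> qr; have qr' : (q + r) / 2%:R < r by lra.
case: (E_located qr') => [pP|]; last by right.
by left; exists ((q + r) / 2%:R); split=> //; lra.
Qed.

Definition real_inf : real :=
  Real inf_lower_inh inf_upper_inh inf_lower_rounded inf_upper_rounded
       inf_disjoint inf_cut_located.
End Infimum.

Record metricSpace := MetricSpace {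
  mcarrier :> Type;
  meq : mcarrier -> mcarrier -> Prop;
  dist : mcarrier -> mcarrier -> real;
  meq_refl : forall x, meq x x;
  meq_sym : forall x y, meq x y -> meq y x;
  meq_trans : forall x y z, meq x y -> meq y z -> meq x z;
  dist_eq0 : forall x y, req (dist x y) (rat_real 0) <-> meq x y;
  dist_sym : forall x y, req (dist x y) (dist y x);
  dist_triangle : forall x y z, rle (dist x z) (radd (dist x y) (dist y z)) }.

Arguments meq_refl {m} x.
Arguments meq_sym {m} x y _.
Arguments meq_trans {m} x y z _ _.
Arguments dist_eq0 {m} x y.
Arguments dist_sym {m} x y.
Arguments dist_triangle {m} x y z.

Section MetricFacts.
Variable X : metricSpace.
Implicit Types x y z : X.

Lemma upper_dist_trans x y z (p q r : rat) : p + q <= r ->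
  upper (dist x y) p -> upper (dist y z) q -> upper (dist x z) r.
Proof.
move=> pqr xyp yzq; apply: upper_le pqr _.
by apply: ((rle_upper _ _).1 (dist_triangle x y z)); exists p, q.
Qed.

Lemma upper_dist_sym x y q : upper (dist x y) q -> upper (dist y x) q.
Proof. by move: q; apply/rle_upper; case: (dist_sym x y). Qed.

Lemma upper_dist_refl x q : 0 < q -> upper (dist x x) q.
Proof.
move=> q0; case/dist_eq0: (meq_refl x) => le0 _.
by apply: ((rle_upper _ _).1 le0).
Qed.

Lemma upper_dist_gt0 x y q : upper (dist x y) q -> 0 < q.
Proof.
move=> /upper_rounded [p [pq xyp]]; case: (ltP 0 q) => // q0.
have : upper (dist x x) (p + p).
  exact: upper_dist_trans (lexx _) xyp (upper_dist_sym xyp).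
case/dist_eq0: (meq_refl x) => _ /rle_upper ge0 /ge0 /=; lra.
Qed.
End MetricFacts.

Section Subspace.
Variables (X : metricSpace) (A : X -> Prop).

Definition subspace : metricSpace := {|
  mcarrier := {x : X | A x};
  meq x y := meq (sval x) (sval y);
  dist x y := dist (sval x) (sval y);
  meq_refl x := meq_refl (sval x);
  meq_sym x y := meq_sym (sval x) (sval y);
  meq_trans x y z := meq_trans (sval x) (sval y) (sval z);
  dist_eq0 x y := dist_eq0 (sval x) (sval y);
  dist_sym x y := dist_sym (sval x) (sval y);
  dist_triangle x y z := dist_triangle (sval x) (sval y) (sval z) |}.
End Subspace.

(* The domain {0, ..., n} is never empty: a K-finite subset is inhabited. *)
Definition K_finite (T : Type) (A : T -> Prop) : Prop :=
  exists (n : nat) (f : 'I_n.+1 -> T), forall x, A x <-> exists i, f i = x.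

(* A set of balls is given by the set of their (center, radius) pairs. *)
Definition totally_bounded (X : metricSpace) : Prop :=
  forall e : real, rlt (rat_real 0) e ->
    exists B : X * real -> Prop,
      [/\ K_finite B,
          forall b, B b -> rlt (rat_real 0) b.2 /\ rle b.2 e &
          forall x : X, exists b, B b /\ rlt (dist b.1 x) b.2].

Definition cauchy (X : metricSpace) (s : nat -> X) : Prop :=
  forall e : real, rlt (rat_real 0) e ->
    exists N : nat, forall m n : nat, (N <= m)%N -> (N <= n)%N ->
      rlt (dist (s m) (s n)) e.

Definition converges (X : metricSpace) (s : nat -> X) (x : X) : Prop :=
  forall e : real, rlt (rat_real 0) e ->
    exists N : nat, forall n : nat, (N <= n)%N -> rlt (dist (s n) x) e.

Definition complete (X : metricSpace) : Prop :=
  forall s : nat -> X, cauchy s -> exists x, converges s x.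

Definition Bishop_compact (X : metricSpace) (A : X -> Prop) : Prop :=
  complete (subspace A) /\ totally_bounded (subspace A).

Definition cov_all (S : Type) (cov : S -> (S -> Prop) -> Prop)
  (U V : S -> Prop) : Prop := forall u, U u -> cov u V.

Definition down (S : Type) (le : S -> S -> Prop) (U V : S -> Prop) : S -> Prop :=
  fun x => exists u, U u /\ exists v, V v /\ le x u /\ le x v.

Record formalTopology := FormalTopology {
  opens :> Type;
  fle : opens -> opens -> Prop;
  cov : opens -> (opens -> Prop) -> Prop;
  fle_refl : forall a, fle a a;
  fle_trans : forall a b c, fle a b -> fle b c -> fle a c;
  cov_ref : forall a (U : opens -> Prop), U a -> cov a U;
  cov_tra : forall a U V, cov a U -> cov_all cov U V -> cov a V;
  cov_loc : forall a U V, cov a U -> cov a V -> cov a (down fle U V);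
  cov_ext : forall a b, fle a b -> cov a (fun x => x = b) }.

Section FormalTopologyDefs.
Variable M : formalTopology.

Definition compact : Prop :=
  forall U : M -> Prop, (forall a : M, cov a U) ->
    exists U0 : M -> Prop,
      [/\ K_finite U0, forall a, U0 a -> U a & forall a : M, cov a U0].

Definition positivity (Pos : M -> Prop) : Prop :=
  (forall U : M -> Prop, cov_all (@cov M) U (fun u => U u /\ Pos u)) /\
  (forall (u : M) (V : M -> Prop), Pos u -> cov u V -> exists v, V v /\ Pos v).

Definition overt : Prop := exists Pos, positivity Pos.

Definition is_point (alpha : M -> Prop) : Prop :=
  [/\ exists a, alpha a,
      forall a b, alpha a -> alpha b ->
        exists c, alpha c /\ fle c a /\ fle c b &
      forall a (U : M -> Prop), alpha a -> cov a U -> exists u, U u /\ alpha u].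

Definition point : Type := {alpha : M -> Prop | is_point alpha}.
End FormalTopologyDefs.

Lemma point_up (M : formalTopology) (alpha : point M) a b :
  fle a b -> sval alpha a -> sval alpha b.
Proof.
case: alpha => alpha [/= _ _ spl] ab aa.
by have [_ [-> ?]] := spl _ _ aa (cov_ext ab).
Qed.

Section ClosedSublocale.
Variables (M : formalTopology) (O : M -> Prop).

Definition closed_cov (u : M) (V : M -> Prop) : Prop :=
  cov u (fun x => V x \/ O x).

Lemma closed_cov_ref a (U : M -> Prop) : U a -> closed_cov a U.
Proof. by move=> Ua; apply: cov_ref; left. Qed.

Lemma closed_cov_tra a U V :
  closed_cov a U -> cov_all closed_cov U V -> closed_cov a V.
Proof.
move=> aU UV; apply: cov_tra aU _ => x [/UV//|Ox].
by apply: cov_ref; right.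
Qed.

Lemma closed_cov_loc a U V :
  closed_cov a U -> closed_cov a V -> closed_cov a (down (@fle M) U V).
Proof.
move=> aU aV; apply: cov_tra (cov_loc aU aV) _ => x [u [Uu [v [Vv [xu xv]]]]].
case: Uu => [Uu|Ou]; last first.
  by apply: cov_tra (cov_ext xu) _ => _ ->; apply: cov_ref; right.
case: Vv => [Vv|Ov]; last first.
  by apply: cov_tra (cov_ext xv) _ => _ ->; apply: cov_ref; right.
by apply: cov_ref; left; exists u; split=> //; exists v.
Qed.

Lemma closed_cov_ext a b : fle a b -> closed_cov a (fun x => x = b).
Proof.
move=> ab; apply: cov_tra (cov_ext ab) _ => _ ->.
by apply: cov_ref; left.
Qed.

Definition closed_sublocale : formalTopology := {|
  opens := M;
  fle := @fle M;
  cov := closed_cov;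
  fle_refl := @fle_refl M;
  fle_trans := @fle_trans M;
  cov_ref := closed_cov_ref;
  cov_tra := closed_cov_tra;
  cov_loc := closed_cov_loc;
  cov_ext := closed_cov_ext |}.

Lemma closed_sublocale_point (alpha : M -> Prop) :
  @is_point closed_sublocale alpha -> is_point alpha.
Proof.
case=> inh flt spl; split=> // a U aa aU; apply: spl aa _.
by apply: cov_tra aU _ => u Uu; apply: cov_ref; left.
Qed.
End ClosedSublocale.

(* The least relation satisfying the axioms of a formal topology on (S, le)
   and containing [ax]. *)
Inductive generated_cov (S : Type) (le : S -> S -> Prop)
    (ax : S -> (S -> Prop) -> Prop) : S -> (S -> Prop) -> Prop :=
| gen_ax a U : ax a U -> generated_cov le ax a U
| gen_ref a (U : S -> Prop) : U a -> generated_cov le ax a U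
| gen_tra a U V : generated_cov le ax a U ->
    (forall u, U u -> generated_cov le ax u V) -> generated_cov le ax a V
| gen_loc a U V : generated_cov le ax a U -> generated_cov le ax a V ->
    generated_cov le ax a (down le U V)
| gen_ext a b : le a b -> generated_cov le ax a (fun x => x = b).

Definition posrat : Type := {r : rat | 0 < r}.

Section LocalicCompletion.
Variable X : metricSpace.

(* The pair (x, r) is the basic open b(x, r). *)
Definition basic : Type := (X * posrat)%type.
Definition center (u : basic) : X := u.1.
Definition radius (u : basic) : rat := sval u.2.

Definition basic_lt (u v : basic) : Prop :=
  rlt (dist (center u) (center v)) (rat_real (radius v - radius u)).

Definition basic_le (u v : basic) : Prop :=
  forall t : rat, radius v - radius u < t ->
    rlt (dist (center u) (center v)) (rat_real t).

Inductive completion_ax : basic -> (basic -> Prop) -> Prop :=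
| M1 u : completion_ax u (fun v => basic_lt v u)
| M2 u (r : posrat) : completion_ax u (fun v => exists x : X, v = (x, r)).

Lemma rlt_rat (x : real) (q : rat) : rlt x (rat_real q) <-> upper x q.
Proof.
split=> [[p [xp /= pq]]|/upper_rounded [p [pq xp]]]; last by exists p.
exact: upper_lt xp.
Qed.

Lemma basic_le_refl u : basic_le u u.
Proof.
by move=> t; rewrite subrr => t0; apply/rlt_rat/upper_dist_refl.
Qed.

Lemma basic_le_trans u v w : basic_le u v -> basic_le v w -> basic_le u w.
Proof.
move=> uv vw t ut; apply/rlt_rat.
pose e := (t - (radius w - radius u)) / 2%:R.
apply: (@upper_dist_trans _ _ (center v) _ (radius v - radius u + e)
         (radius w - radius v + e)); first by rewrite /e; lra.
  by apply/rlt_rat/uv; rewrite /e; lra.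
by apply/rlt_rat/vw; rewrite /e; lra.
Qed.

Definition localic_completion : formalTopology := {|
  opens := basic;
  fle := basic_le;
  cov := generated_cov basic_le completion_ax;
  fle_refl := basic_le_refl;
  fle_trans := basic_le_trans;
  cov_ref := @gen_ref _ _ _;
  cov_tra := @gen_tra _ _ _;
  cov_loc := @gen_loc _ _ _;
  cov_ext := @gen_ext _ _ _ |}.

Notation Pt := (point localic_completion).
Implicit Types alpha beta gamma : Pt.

Definition point_dists alpha beta (e : real) : Prop :=
  exists a b : basic, [/\ sval alpha a, sval beta b &
    e = radd (radd (dist (center a) (center b)) (rat_real (radius a)))
             (rat_real (radius b))].

Definition point_eq alpha beta : Prop :=
  forall a : basic, sval alpha a <-> sval beta a.

Lemma radius_gt0 (u : basic) : 0 < radius u.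
Proof. exact: svalP u.2. Qed.

Lemma lower_raddq (x : real) (q p : rat) :
  lower (radd x (rat_real q)) p <-> lower x (p - q).
Proof.
split=> [[a [b [xa /= bq ->]]]|/lower_rounded [r [pr xr]]].
  by apply: lower_lt xa; lra.
by exists r, (p - r); split=> //=; lra.
Qed.

Lemma upper_raddq (x : real) (q p : rat) :
  upper (radd x (rat_real q)) p <-> upper x (p - q).
Proof.
split=> [[a [b [xa /= bq ->]]]|/upper_rounded [r [pr xr]]].
  by apply: upper_lt xa; lra.
by exists r, (p - r); split=> //=; lra.
Qed.

Lemma point_small alpha (e : rat) : 0 < e ->
  exists a : basic, sval alpha a /\ radius a < e.
Proof.
case: alpha => alpha /= [[a aa] _ spl] e0.
have h0 : 0 < e / 2%:R by lra.
pose r : posrat := exist _ (e / 2%:R) h0.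
have [_ [[x ->] xa]] := spl a _ aa (gen_ax basic_le (M2 a r)).
by exists (x, r); split=> //; rewrite /radius /=; lra.
Qed.

Lemma point_meet alpha (a b : basic) : sval alpha a -> sval alpha b ->
  upper (dist (center a) (center b)) (radius a + radius b).
Proof.
case: alpha => alpha /= [_ flt _] aa ab.
have [c [_ [ca cb]]] := flt a b aa ab.
have c0 := radius_gt0 c.
apply: (@upper_dist_trans _ _ (center c) _ (radius a) (radius b)) => //.
  by apply/upper_dist_sym/rlt_rat/ca; lra.
by apply/rlt_rat/cb; lra.
Qed.

Lemma point_dists_inh alpha beta : exists e, point_dists alpha beta e.
Proof.
have [a [aa _]] := point_small alpha ltr01.
have [b [bb _]] := point_small beta ltr01.
by eexists; exists a, b.
Qed.

Lemma lower_dist_lt0 (x y : X) q : q < 0 -> lower (dist x y) q.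
Proof.
by move=> q0; case: (cut_located (dist x y) q0) => // /upper_dist_gt0; lra.
Qed.

Lemma point_dists_bounded alpha beta :
  exists p : rat, forall e, point_dists alpha beta e -> rle (rat_real p) e.
Proof.
exists 0 => _ [a [b [_ _ ->]]] q /= q0.
have a0 := radius_gt0 a; have b0 := radius_gt0 b.
by apply/lower_raddq/lower_raddq/lower_dist_lt0; lra.
Qed.

Lemma point_dists_located alpha beta : inf_located (point_dists alpha beta).
Proof.
move=> p q pq; have e0 : 0 < (q - p) / 4%:R by lra.
have [a [aa ae]] := point_small alpha e0.
have [b [bb be]] := point_small beta e0.
have lt_pq : p + radius a + radius b < q - radius b - radius a by lra.
case: (cut_located (dist (center a) (center b)) lt_pq) => [lo|up]; last first.
  right; eexists; split; first by exists a, b.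
  by apply/rlt_rat/upper_raddq/upper_raddq.
left=> _ [a' [b' [aa' bb' ->]]] r /= rp; apply/lower_raddq/lower_raddq.
have lt_rp : r - radius b' - radius a' < p - radius b' - radius a' by lra.
case: (cut_located (dist (center a') (center b')) lt_rp) => // up.
have up1 : upper (dist (center a) (center b')) (p - radius b' + radius a).
  by apply: upper_dist_trans (point_meet aa aa') up; lra.
have up2 : upper (dist (center a) (center b)) (p + radius a + radius b).
  by apply: upper_dist_trans up1 (point_meet bb' bb); lra.
by case: (cut_disjoint (conj lo up2)).
Qed.

Definition point_dist alpha beta : real :=
  real_inf (point_dists_inh alpha beta) (point_dists_bounded alpha beta)
           (@point_dists_located alpha beta).

Lemma upper_point_dist alpha beta q : upper (point_dist alpha beta) q <->
  exists a b : basic, [/\ sval alpha a, sval beta b &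
    upper (dist (center a) (center b)) (q - radius b - radius a)].
Proof.
split=> [[_ [[a [b [aa bb ->]]] /rlt_rat/upper_raddq/upper_raddq]]|].
  by exists a, b.
case=> a [b [aa bb ab]]; eexists; split; first by exists a, b.
by apply/rlt_rat/upper_raddq/upper_raddq.
Qed.

Lemma point_eq_refl alpha : point_eq alpha alpha.
Proof. by []. Qed.

Lemma point_eq_sym alpha beta : point_eq alpha beta -> point_eq beta alpha.
Proof. by move=> ab a; split=> /ab. Qed.

Lemma point_eq_trans alpha beta gamma :
  point_eq alpha beta -> point_eq beta gamma -> point_eq alpha gamma.
Proof. by move=> ab bc a; split=> [/ab/bc|/bc/ab]. Qed.

Lemma point_dist_le alpha beta :
  rle (point_dist alpha beta) (point_dist beta alpha).
Proof.
apply/rle_upper => q /upper_point_dist [b [a [bb aa /upper_dist_sym ab]]].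
by apply/upper_point_dist; exists a, b; split=> //; apply: upper_le ab; lra.
Qed.

Lemma point_dist_sym alpha beta :
  req (point_dist alpha beta) (point_dist beta alpha).
Proof. by split; apply: point_dist_le. Qed.

Lemma point_dist_triangle alpha beta gamma :
  rle (point_dist alpha gamma)
      (radd (point_dist alpha beta) (point_dist beta gamma)).
Proof.
apply/rle_upper => _ [p [q [/upper_point_dist [a [b [aa bb ab]]]
                            /upper_point_dist [b' [c [bb' cc bc]]] ->]]].
apply/upper_point_dist; exists a, c; split=> //.
have up : upper (dist (center a) (center b')) (p - radius a + radius b').
  by apply: upper_dist_trans ab (point_meet bb bb'); lra.
by apply: upper_dist_trans up bc; lra.
Qed.

Lemma point_dist_eq0 alpha beta :
  req (point_dist alpha beta) (rat_real 0) <-> point_eq alpha beta.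
Proof.
split=> [|ab].
  have incl (al be : Pt) : req (point_dist al be) (rat_real 0) ->
      forall a, sval al a -> sval be a.
    case=> /rle_upper d0 _ a aa.
    have [_ _ spl] := svalP al.
    have [a' [/rlt_rat/upper_rounded [p [pa a'p]] aa']] :=
      spl a _ aa (gen_ax basic_le (M1 a)).
    have /d0/upper_point_dist [b [c [bb cc bc]]] :
      upper (rat_real 0) (radius a - radius a' - p) by rewrite /=; lra.
    apply: point_up cc => t tP; apply/rlt_rat.
    have up : upper (dist (center a') (center c)) (radius a - p - radius c).
      by apply: upper_dist_trans (point_meet aa' bb) bc; lra.
    by apply: upper_dist_trans (upper_dist_sym up) a'p; lra.
  move=> d0 a; split; first exact: incl.
  apply: incl; case: d0 (point_dist_sym alpha beta) => d1 d2 [d3 d4].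
  by split=> q; [move=> /d4/d1 | move=> /d2/d3].
split; apply/rle_upper => q.
  move=> /= q0; have e0 : 0 < q / 2%:R by lra.
  have [a [aa ae]] := point_small alpha e0.
  apply/upper_point_dist; exists a, a; split=> //; first exact/ab.
  by apply: upper_dist_refl; lra.
move=> /upper_point_dist [a [b [_ _ /upper_dist_gt0]]] /=.
by have := radius_gt0 a; have := radius_gt0 b; lra.
Qed.

Definition Pt_metric : metricSpace := {|
  mcarrier := Pt;
  meq := point_eq;
  dist := point_dist;
  meq_refl := point_eq_refl;
  meq_sym := point_eq_sym;
  meq_trans := point_eq_trans;
  dist_eq0 := point_dist_eq0;
  dist_sym := point_dist_sym;
  dist_triangle := point_dist_triangle |}.

(* By [closed_sublocale_point] this subset contains every point of the closed
   sublocale. *)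
Definition Pt_closed (O : localic_completion -> Prop) : Pt_metric -> Prop :=
  fun alpha => @is_point (closed_sublocale O) (sval alpha).
End LocalicCompletion.

(* Main.v *)
(* A decreasing sequence of positive opens whose radii tend to 0 generates a
   point of the completion, and this point avoids O because no element of O is
   positive in M \ O. Dependent choice thus puts a point of M \ O into every
   positive open. Total boundedness follows by applying compactness to the
   positive balls of a fixed small radius. Completeness needs neither
   hypothesis: the limit of a Cauchy sequence of points consists of the opens
   having a strictly smaller open that eventually belongs to the sequence, and
   it avoids O because the members of the sequence do. *)
From mathcomp Require Import all_boot all_order all_algebra.
From mathcomp Require Import lra.
Require Import Defs.

Set Implicit Arguments.
Unset Strict Implicit.
Unset Printing Implicit Defensive.

Import Order.TTheory GRing.Theory Num.Theory.
Local Open Scope ring_scope.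

(** Finite choice, by induction on [n]; it will pick a point in each ball of a finite cover. *)
Lemma ord_choice (n : nat) (T : Type) (P : 'I_n -> T -> Prop) :
  (forall i, exists x, P i x) -> exists f : 'I_n -> T, forall i, P i (f i).
Proof.
elim: n P => [|n IH] P ex.
  by exists (fun i : 'I_0 => False_rect T (notF (ltn_ord i))) => -[].
have [f fP] := IH _ (fun i => ex (lift ord0 i)).
have [x xP] := ex ord0.
exists (fun i => if unlift ord0 i is Some j then f j else x) => i.
by case: unliftP => [j|] ->.
Qed.

(** * Basic opens and points of the localic completion *)

Section BasicOpens.
Variable X : metricSpace.
Implicit Types u v w a b c : basic X.

Lemma basic_ltP u v :
  basic_lt u v <-> upper (dist (center u) (center v)) (radius v - radius u).
Proof. exact: rlt_rat. Qed.

Lemma basic_lt_le u v : basic_lt u v -> basic_le u v.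
Proof. by move=> /basic_ltP uv t ut; apply/rlt_rat/(upper_lt ut). Qed.

(** The strict inequality leaves slack above some [p], which absorbs the arbitrarily small excess
    allowed by [basic_le]. *)
Lemma basic_le_lt_trans u v w : basic_le u v -> basic_lt v w -> basic_lt u w.
Proof.
move=> uv /basic_ltP/upper_rounded [p [pr vw]].
apply/basic_ltP; apply: upper_dist_trans (_ : _ + p <= _) _ vw; last first.
  by apply/rlt_rat/uv; apply: (_ : _ < radius w - radius u - p); lra.
by lra.
Qed.

Lemma basic_lt_le_trans u v w : basic_lt u v -> basic_le v w -> basic_lt u w.
Proof.
move=> /basic_ltP/upper_rounded [p [pr uv]] vw.
apply/basic_ltP; apply: upper_dist_trans (_ : p + _ <= _) uv _; last first.
  by apply/rlt_rat/vw; apply: (_ : _ < radius w - radius u - p); lra.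
by lra.
Qed.

Lemma basic_le_radius u v : basic_le u v -> radius u <= radius v.
Proof.
move=> uv; case: leP => // vu.
have /uv/rlt_rat/upper_dist_gt0 : radius v - radius u < 0 by lra.
by lra.
Qed.

Definition ball_open (x : X) (r : rat) (r0 : 0 < r) : basic X :=
  (x, exist _ r r0).

Lemma radius_ball_open x (r : rat) (r0 : 0 < r) : radius (ball_open x r0) = r.
Proof. by []. Qed.

Lemma basic_lt_enlarge u (r : rat) (r0 : 0 < r) :
  radius u < r -> basic_lt u (ball_open (center u) r0).
Proof. by move=> ur; apply/basic_ltP/upper_dist_refl; rewrite subr_gt0. Qed.

Lemma basic_lt_dense u v : basic_lt u v ->
  exists w, basic_lt u w /\ basic_lt w v.
Proof.
move=> /basic_ltP/upper_rounded [p [pr uv]].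
have p0 := upper_dist_gt0 uv; have u0 := radius_gt0 u.
(* The radius is the midpoint of the gap between [radius u + p] and [radius v]. *)
have r0 : 0 < (radius u + p + radius v) / 2%:R by lra.
exists (ball_open (center v) r0); split; apply/basic_ltP.
  by apply: upper_lt uv; rewrite !radius_ball_open; lra.
by apply: upper_dist_refl; rewrite !radius_ball_open; lra.
Qed.

(** Induction on the generated cover: the third hypothesis handles M1, the fourth M2, filtering
    handles (Loc), and upward closure (Ext). *)
Lemma is_point_localic_completion (alpha : localic_completion X -> Prop) :
  (forall a b, alpha a -> alpha b ->
     exists c, alpha c /\ basic_le c a /\ basic_le c b) ->
  (forall a b, basic_le a b -> alpha a -> alpha b) ->
  (forall a, alpha a -> exists b, basic_lt b a /\ alpha b) ->
  (forall r : posrat, exists x : X, alpha (x, r)) ->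
  is_point alpha.
Proof.
move=> flt up rnd small; split=> //.
  by have [x xP] := small (exist _ 1 ltr01); exists (x, exist _ 1 ltr01).
move=> a U aa aU; elim: aU aa => {a U}.
- move=> a U [{}a|{}a r] aa; first exact: rnd.
  by have [x xP] := small r; exists (x, r); split=> //; exists x.
- by move=> a U Ua aa; exists a.
- by move=> a U V _ IHU _ IHV /IHU [u [Uu /(IHV _ Uu)]].
- move=> a U V _ IHU _ IHV aa.
  have [u [Uu au]] := IHU aa; have [v [Vv av]] := IHV aa.
  have [c [ac [cu cv]]] := flt _ _ au av.
  by exists c; split=> //; exists u; split=> //; exists v.
- by move=> a b ab aa; exists b; split=> //; exact: up aa.
Qed.

Lemma point_dist_common (alpha beta : Pt_metric X) a b (e : rat) :
  sval alpha a -> sval beta b -> center a = center b ->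
  radius a + radius b < e -> upper (point_dist alpha beta) e.
Proof.
move=> aa bb ab lt_e; apply/upper_point_dist; exists a, b; split=> //.
by rewrite ab; apply: upper_dist_refl; lra.
Qed.

(** The distance bound yields [a'] in [alpha] near some [b'] in [beta]. Since [a] and [a'] meet, the
    triangle inequality puts [b'] below [b]. *)
Lemma point_dist_enlarge (alpha beta : Pt_metric X) a b (e : rat) :
  upper (point_dist alpha beta) e -> sval alpha a ->
  center b = center a -> radius a + e <= radius b -> sval beta b.
Proof.
move=> /upper_point_dist [a' [b' [aa' bb' a'b']]] aa cE rE.
apply: point_up bb' => t tP; apply/rlt_rat.
rewrite cE; apply/upper_dist_sym.
by apply: upper_dist_trans (point_meet aa aa') a'b'; lra.
Qed.

Lemma cauchy_upper (A : Pt_metric X -> Prop) (s : nat -> subspace A) :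
  cauchy s -> forall e : rat, 0 < e -> exists N, forall m n,
    (N <= m)%N -> (N <= n)%N -> upper (point_dist (sval (s m)) (sval (s n))) e.
Proof.
move=> cs e e0; have [|N NP] := cs (rat_real e); first exact/rlt_rat.
by exists N => m n Nm Nn; apply/rlt_rat/NP.
Qed.

(** * Points of the closed sublocale *)

Section Sublocale.
Variable O : localic_completion X -> Prop.

Lemma is_point_closed (alpha : localic_completion X -> Prop) :
  is_point alpha -> (forall a, alpha a -> ~ O a) ->
  @is_point (closed_sublocale O) alpha.
Proof.
case=> inh flt spl avoid; split=> // a U aa /(spl a _ aa) [u [[Uu|Ou] au]].
  by exists u.
by case: (avoid u au Ou).
Qed.

Lemma closed_cov_of_cov (a : localic_completion X) U :
  cov a U -> closed_cov O a U.
Proof. by move=> aU; apply: cov_tra aU _ => u Uu; apply: cov_ref; left. Qed.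

(** Neither a member of a point nor a positive open has an empty cover, so this keeps both out of
    [O]. *)
Lemma closed_cov_empty (a : localic_completion X) :
  O a -> closed_cov O a (fun _ => False).
Proof. by move=> Oa; apply: cov_ref; right. Qed.

Lemma closed_point_avoids (alpha : localic_completion X -> Prop) a :
  @is_point (closed_sublocale O) alpha -> alpha a -> ~ O a.
Proof.
by case=> _ _ spl aa Oa; have [_ [[] _]] := spl a _ aa (closed_cov_empty Oa).
Qed.

(** * Points in positive opens *)

Section PositivePoints.
Hypothesis DC : dependent_choice.
Variable Pos : localic_completion X -> Prop.
Hypothesis PosP : @positivity (closed_sublocale O) Pos.

(** (Loc) combines the M1 cover with the M2 cover by balls of half the radius; (Mon) then selects a
    positive member. *)
Lemma positive_shrink u : Pos u ->
  exists v, [/\ Pos v, basic_lt v u & radius v <= radius u / 2%:R].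
Proof.
move=> pu; have u0 := radius_gt0 u.
have r0 : 0 < radius u / 2%:R by lra.
pose r : posrat := exist _ (radius u / 2%:R) r0.
have cov_u := gen_loc (gen_ax (@basic_le X) (M1 u))
  (gen_ax (@basic_le X) (M2 u r)).
have [v [[w [wu [_ [[x ->] [vw vx]]]]] pv]] :=
  PosP.2 u _ pu (closed_cov_of_cov cov_u).
exists v; split=> //; first exact: basic_le_lt_trans vw wu.
exact: basic_le_radius vx.
Qed.

Lemma positive_point u : Pos u ->
  exists alpha : subspace (@Pt_closed X O), sval (sval alpha) u.
Proof.
move=> pu.
pose R (v w : {v | Pos v}) :=
  basic_lt (sval w) (sval v) /\ radius (sval w) <= radius (sval v) / 2%:R.
have [|f [f0 fR]] := DC (R := R) _ (exist _ u pu).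
  by case=> v pv; have [w [pw wv rw]] := positive_shrink pv;
    exists (exist _ w pw).
have f_le m n : (m <= n)%N -> basic_le (sval (f n)) (sval (f m)).
  move=> /subnKC <-; elim: (n - m)%N => [|k IH].
    by rewrite addn0; apply: basic_le_refl.
  rewrite addnS; apply: basic_le_trans IH.
  exact: basic_lt_le (fR _).1.
have f_small (e : rat) : 0 < e -> exists n, radius (sval (f n)) < e.
  move=> e0; pose n := Num.bound (radius u / e).
  (* Halving gives this linear decay because [k + 2 <= 2 * (k + 1)]; the Archimedean property then
     makes the radii small. *)
  have rn k : radius (sval (f k)) * k.+1%:R <= radius u.
    elim: k => [|k]; first by rewrite f0 mulr1.
    have := (fR k).2; have := radius_gt0 (sval (f k.+1)).
    rewrite -[k.+2%:R]natr1 -[k.+1%:R]natr1.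
    have : 0 <= k%:R :> rat by exact: ler0n.
    by nra.
  exists n; have n_big : radius u < n%:R * e.
    rewrite -ltr_pdivrMr //; apply: archi_boundP.
    by apply: divr_ge0; apply: ltW => //; apply: radius_gt0.
  have := rn n; rewrite -natr1.
  have : 0 <= n%:R :> rat by exact: ler0n.
  by have := radius_gt0 (sval (f n)); nra.
(* The strict order makes roundedness follow from density of [basic_lt]. *)
pose alpha (v : localic_completion X) := exists n, basic_lt (sval (f n)) v.
have alpha_f n : alpha (sval (f n)) by exists n.+1; apply: (fR n).1.
have alphaP : is_point alpha.
  apply: is_point_localic_completion.
  - move=> a b [m ma] [n nb]; exists (sval (f (maxn m n))); split=> //.
    split; apply: basic_lt_le.
      exact: basic_le_lt_trans (f_le _ _ (leq_maxl _ _)) ma.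
    exact: basic_le_lt_trans (f_le _ _ (leq_maxr _ _)) nb.
  - by move=> a b ab [n na]; exists n; apply: basic_lt_le_trans ab.
  - move=> a [n /basic_lt_dense [b [nb ba]]].
    by exists b; split=> //; exists n.
  - move=> [r r0]; have [n rn] := f_small r r0.
    by exists (center (sval (f n))), n; apply: basic_lt_enlarge.
have alpha_closed : @is_point (closed_sublocale O) alpha.
  apply: is_point_closed alphaP _ => a [n na] Oa.
  (* Lying below [a] in [O], the positive open [f n] would have an empty cover. *)
  have [|_ [[] _]] := PosP.2 (sval (f n)) (fun _ => False) (svalP (f n)).
    apply: (closed_cov_tra (closed_cov_ext O (basic_lt_le na))) => _ ->.
    exact: closed_cov_empty.
exists (exist (@Pt_closed X O) (exist _ alpha alphaP) alpha_closed) => /=.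
by have := alpha_f 0%N; rewrite f0.
Qed.

(** * Total boundedness *)

Lemma positive_balls_cov (r : posrat) u :
  closed_cov O u (fun v => (exists x, v = (x, r)) /\ Pos v).
Proof.
(* M2 covers by all balls of radius [r], and (Pos) keeps the positive ones. *)
exact: (closed_cov_tra (closed_cov_of_cov (gen_ax _ (M2 u r))) (PosP.1 _)).
Qed.

Lemma totally_bounded_closed :
  compact (closed_sublocale O) -> totally_bounded (subspace (@Pt_closed X O)).
Proof.
move=> cpt e [q [/= q0 eq]].
(* Two points sharing a ball of radius [q / 4] are less than [q] apart. *)
have r0 : 0 < q / 4%:R by lra.
pose r : posrat := exist _ (q / 4%:R) r0.
have [U0 [[n [f fP]] U0_sub U0_cov]] :=
  cpt _ (positive_balls_cov r).
have [|g gP] := @ord_choice _ (subspace (@Pt_closed X O))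
    (fun i alpha => sval (sval alpha) (f i)).
  move=> i; apply: positive_point.
  by have [_] := U0_sub (f i) ((fP _).2 (ex_intro _ i erefl)).
exists (fun p => exists i, (g i, rat_real q) = p); split.
- by exists n, (fun i => (g i, rat_real q)).
- move=> _ [i <-] /=; split; first exact/rlt_rat.
  by move=> p /= pq; apply: lower_lt pq eq.
- move=> beta; have [[a ba] _ spl] := svalP beta.
  have [_ [/fP [i <-] bf]] := spl a U0 ba (U0_cov a).
  exists (g i, rat_real q); split; first by exists i.
  have [[x fE] _] := U0_sub (f i) ((fP _).2 (ex_intro _ i erefl)).
  apply/rlt_rat/(point_dist_common (gP i) bf (erefl _)).
  by rewrite fE /radius /=; lra.
Qed.

End PositivePoints.

(** * Completeness *)

Lemma complete_closed : complete (subspace (@Pt_closed X O)).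
Proof.
move=> s /cauchy_upper cs.
pose t n := sval (sval (s n)).
pose alpha (v : localic_completion X) :=
  exists w, basic_lt w v /\ exists N, forall n, (N <= n)%N -> t n w.
(* From [N] on, the terms are within [d] of each other. An open of one such term, enlarged by [d],
   thus belongs to all of them, and anything strictly larger belongs to the limit. *)
have enlarge (d : rat) : 0 < d -> exists N, forall n, (N <= n)%N ->
    forall a b c, t n a -> center b = center a -> radius a + d <= radius b ->
    basic_lt b c -> (forall m, (N <= m)%N -> t m b) /\ alpha c.
  move=> d0; have [N NP] := cs d d0; exists N => n Nn a b c ta bE rb bc.
  have tb m : (N <= m)%N -> t m b.
    by move=> Nm; apply: point_dist_enlarge (NP _ _ Nn Nm) ta bE rb.
  by split=> //; exists b; split=> //; exists N.
have small (n : nat) (d : rat) : 0 < d -> exists a, t n a /\ radius a < d.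
  exact: point_small.
have up n a b : basic_le a b -> t n a -> t n b.
  exact: (@point_up _ (sval (s n))).
have alphaP : is_point alpha.
  apply: is_point_localic_completion.
  - move=> a b [a' [/basic_ltP/upper_rounded [p [pa aa']] [Na tNa]]].
    case=> b' [/basic_ltP/upper_rounded [q [qb bb']] [Nb tNb]].
    (* Of the three shares of the slack, two enlarge [c] to radius [radius c + 2 * d] and one pays
       for the excess in [basic_le]. *)
    pose d := Num.min (radius a - radius a' - p) (radius b - radius b' - q)
      / 3%:R.
    have d0 : 0 < d by rewrite divr_gt0 // lt_min !subr_gt0 pa qb.
    have da : 3%:R * d <= radius a - radius a' - p.
      by rewrite mulrC divfK // ge_min lexx.
    have db : 3%:R * d <= radius b - radius b' - q.
      by rewrite mulrC divfK // ge_min lexx orbT.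
    have [N NP] := enlarge d d0.
    (* At this index [a'] and [b'] both belong to [t n], whose filtering supplies [c]. *)
    pose n := maxn N (maxn Na Nb).
    have [c [tc [ca cb]]] : exists c, t n c /\ basic_le c a' /\ basic_le c b'.
      have [_ flt _] := svalP (sval (s n)).
      by apply: flt; [apply: tNa | apply: tNb]; rewrite /n !leq_max leqnn ?orbT.
    have c0 := radius_gt0 c.
    have r1 : 0 < radius c + d by lra.
    have r2 : 0 < radius c + 2%:R * d by lra.
    have lt12 : basic_lt (ball_open (center c) r1) (ball_open (center c) r2).
      by apply: basic_lt_enlarge; rewrite !radius_ball_open; lra.
    exists (ball_open (center c) r2); split.
      by apply: (NP n _ c _ _ tc _ _ lt12).2; rewrite // leq_maxl.
    split; apply: basic_lt_le; apply/basic_ltP.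
      apply: upper_dist_trans (_ : (radius a' - radius c + d) + p <= _) _ aa'.
        by rewrite !radius_ball_open; lra.
      by apply/rlt_rat/ca; lra.
    apply: upper_dist_trans (_ : (radius b' - radius c + d) + q <= _) _ bb'.
      by rewrite !radius_ball_open; lra.
    by apply/rlt_rat/cb; lra.
  - move=> a b ab [w [wa wN]]; exists w; split=> //.
    exact: basic_lt_le_trans wa ab.
  - move=> a [w [/basic_lt_dense [b [wb ba]] wN]].
    by exists b; split=> //; exists w.
  (* A ball of radius below [r / 4], enlarged by [r / 4], fits in radius [r / 2], strictly below
     [r]. *)
  - move=> [r r0]; have d0 : 0 < r / 4%:R by lra.
    have [N NP] := enlarge _ d0; have [a [ta ra]] := small N _ d0.
    have r1 : 0 < r / 2%:R by lra.
    exists (center a).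
    apply: (NP N (leqnn N) a (ball_open (center a) r1) _ ta _ _ _).2 => //.
      by rewrite !radius_ball_open; lra.
    by apply: (basic_lt_enlarge r0); rewrite radius_ball_open; lra.
have alpha_closed : @is_point (closed_sublocale O) alpha.
  apply: is_point_closed alphaP _ => a [w [wa [N tN]]].
  apply: (closed_point_avoids (svalP (s N))).
  exact: up (basic_lt_le wa) (tN N (leqnn N)).
exists (exist (@Pt_closed X O) (exist _ alpha alphaP) alpha_closed).
move=> e [q [/= q0 eq]].
(* A ball of [s n] of radius below [q / 8] grows to [q / 4] in [s n] and to [q / 2] in the limit;
   these concentric radii sum to less than [q]. *)
have d0 : 0 < q / 8%:R by lra.
have [N NP] := enlarge _ d0; exists N => n Nn.
have [a [ta ra]] := small n _ d0.
have r1 : 0 < q / 4%:R by lra.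
have r2 : 0 < q / 2%:R by lra.
have [||tb ac] := NP n Nn a (ball_open (center a) r1)
  (ball_open (center a) r2) ta erefl.
- by rewrite !radius_ball_open; lra.
- by apply: basic_lt_enlarge; rewrite radius_ball_open; lra.
exists q; split=> //.
apply: (@point_dist_common (sval (s n)) (exist _ alpha alphaP) _ _ _
  (tb n Nn) ac) => //.
by rewrite !radius_ball_open; lra.
Qed.

End Sublocale.
End BasicOpens.

Theorem theorem3p5 (DC : dependent_choice) (X : metricSpace)
    (O : localic_completion X -> Prop) :
  compact (closed_sublocale O) -> overt (closed_sublocale O) ->
  Bishop_compact (@Pt_closed X O).
Proof.
move=> cpt [Pos PosP]; split; first exact: complete_closed.
exact: totally_bounded_closed DC _ PosP cpt.
Qed.
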